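(* There is a one-to-one correspondence between strict $2$-term $HA_\infty$-algebras and crossed modules of hom-associative algebras.
   Context: Vector spaces are over a field of characteristic zero; the twisting linear maps of the (graded) algebras considered are assumed not identically zero. A hom-associative algebra $(A,\mu,\alpha)$ is a vector space with a bilinear map $\mu$ and a linear map $\alpha$ with $\alpha(\mu(a,b))=\mu(\alpha(a),\alpha(b))$ and $\mu(\alpha(a),\mu(b,c))=\mu(\mu(a,b),\alpha(c))$. A morphism of hom-associative algebras is a linear map preserving products and commuting with the twisting maps. A hom-bimodule $(M,\beta,\cdot)$ over $(A,\mu,\alpha)$ is a vector space $M$ with a linear map $\beta:M\to M$ and bilinear maps $A\otimes M\to M$, $M\otimes A\to M$ with $\beta(a\cdot m)=\alpha(a)\cdot\beta(m)$, $\beta(m\cdot a)=\beta(m)\cdot\alpha(a)$, $\alpha(a)\cdot(b\cdot m)=\mu(a,b)\cdot\beta(m)$, $\beta(m)\cdot\mu(a,b)=(m\cdot a)\cdot\alpha(b)$, $\alpha(a)\cdot(m\cdot b)=(a\cdot m)\cdot\alpha(b)$. A $2$-term $HA_\infty$-algebra $(A_1\xrightarrow{d}A_0,\mu_2,\mu_3,\alpha_0,\alpha_1)$ consists of a linear map $d:A_1\to A_0$, bilinear maps $\mu_2:A_i\otimes A_j\to A_{i+j}$ (with $A_i=0$ for $i\ne0,1$), a trilinear map $\mu_3:A_0^{\otimes3}\to A_1$, and linear maps $\alpha_i:A_i\to A_i$ with $\alpha_0d=d\alpha_1$, $\alpha_1\mu_3=\mu_3\alpha_0^{\otimes3}$ such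 that for $a,b,c,e\in A_0$, $m,n\in A_1$: (a) $\mu_2(m,n)=0$; (b) $\alpha_0\mu_2(a,b)=\mu_2(\alpha_0a,\alpha_0b)$; (c) $\alpha_1\mu_2(a,m)=\mu_2(\alpha_0a,\alpha_1m)$; (d) $\alpha_1\mu_2(m,a)=\mu_2(\alpha_1m,\alpha_0a)$; (e) $d\mu_2(a,m)=\mu_2(a,dm)$; (f) $d\mu_2(m,a)=\mu_2(dm,a)$; (g) $\mu_2(dm,n)=\mu_2(m,dn)$; (h) $d\mu_3(a,b,c)=\mu_2(\mu_2(a,b),\alpha_0c)-\mu_2(\alpha_0a,\mu_2(b,c))$; (i1) $\mu_3(a,b,dm)=\mu_2(\mu_2(a,b),\alpha_1m)-\mu_2(\alpha_0a,\mu_2(b,m))$; (i2) $\mu_3(a,dm,c)=\mu_2(\mu_2(a,m),\alpha_0c)-\mu_2(\alpha_0a,\mu_2(m,c))$; (i3) $\mu_3(dm,b,c)=\mu_2(\mu_2(m,b),\alpha_0c)-\mu_2(\alpha_1m,\mu_2(b,c))$; (j) $\mu_3(\mu_2(a,b),\alpha_0c,\alpha_0e)-\mu_3(\alpha_0a,\mu_2(b,c),\alpha_0e)+\mu_3(\alpha_0a,\alpha_0b,\mu_2(c,e))=\mu_2(\mu_3(a,b,c),\alpha_0^2e)+\mu_2(\alpha_0^2a,\mu_3(b,c,e))$. It is strict if $\mu_3=0$. A crossed module of hom-associative algebras is a tuple $((A,\mu_A,\alpha_A),(B,\mu_B,\alpha_B),dt,\phi)$ where $(A,\mu_A,\alpha_A)$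 and $(B,\mu_B,\alpha_B)$ are hom-associative algebras, $dt:A\to B$ is a morphism of hom-associative algebras, and $\phi:B\otimes A\to A$, $\phi:A\otimes B\to A$ define a hom-bimodule structure (over $B$) on $A$ with respect to $\alpha_A$, such that for $m,n\in A$, $b\in B$: $dt(\phi(b,m))=\mu_B(b,dt(m))$; $dt(\phi(m,b))=\mu_B(dt(m),b)$; $\phi(dt(m),n)=\mu_A(m,n)$; $\phi(m,dt(n))=\mu_A(m,n)$; $\phi(\alpha_B(b),\mu_A(m,n))=\mu_A(\phi(b,m),\alpha_A(n))$; $\phi(\mu_A(m,n),\alpha_B(b))=\mu_A(\alpha_A(m),\phi(n,b))$. *)

(* Defs.v *)
From HB Require Import structures.
From mathcomp Require Import all_boot all_order all_algebra.

Set Implicit Arguments.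
Unset Strict Implicit.
Unset Printing Implicit Defensive.

Import GRing.Theory.
Local Open Scope ring_scope.

Definition not_zero_map (K : fieldType) (V W : lmodType K) (f : V -> W) : Prop :=
  ~ (forall v, f v = 0).

Definition trilinear (K : fieldType) (V W : lmodType K) (f : V -> V -> V -> W)
  : Prop :=
  [/\ forall b c, linear (fun a => f a b c),
      forall a c, linear (fun b => f a b c)
    & forall a b, linear (fun c => f a b c)].

Record hom_assoc (K : fieldType) (A : lmodType K) := HomAssoc {
  ha_mu : {bilinear A -> A -> A};
  ha_alpha : {linear A -> A};
  ha_alpha_neq0 : not_zero_map ha_alpha;
  ha_alphaM : forall a b, ha_alpha (ha_mu a b) = ha_mu (ha_alpha a) (ha_alpha b);
  ha_assoc : forall a b c,
    ha_mu (ha_alpha a) (ha_mu b c) = ha_mu (ha_mu a b) (ha_alpha c) }.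

Definition hom_assoc_morphism (K : fieldType) (A B : lmodType K)
    (SA : hom_assoc A) (SB : hom_assoc B) (f : {linear A -> B}) : Prop :=
  (forall a b, f (ha_mu SA a b) = ha_mu SB (f a) (f b)) /\
  (forall a, f (ha_alpha SA a) = ha_alpha SB (f a)).

Record hom_bimodule (K : fieldType) (A M : lmodType K) (SA : hom_assoc A)
    (beta : {linear M -> M}) (l : {bilinear A -> M -> M})
    (r : {bilinear M -> A -> M}) : Prop := HomBimodule {
  hbm_betal : forall a m, beta (l a m) = l (ha_alpha SA a) (beta m);
  hbm_betar : forall m a, beta (r m a) = r (beta m) (ha_alpha SA a);
  hbm_ll : forall a b m,
    l (ha_alpha SA a) (l b m) = l (ha_mu SA a b) (beta m);
  hbm_rr : forall m a b,
    r (beta m) (ha_mu SA a b) = r (r m a) (ha_alpha SA b);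
  hbm_lr : forall a m b,
    l (ha_alpha SA a) (r m b) = r (l a m) (ha_alpha SA b) }.

(* The binary operation [mu_2] is split into its components [mu00], [mu01],
   [mu10] on [A0 * A0], [A0 * A1], [A1 * A0].  Its component on [A1 * A1] takes
   values in [A_2 = 0]; it carries no data, and [mu_2(m, n) = 0] holds by
   construction. *)
Record HA2 (K : fieldType) (A1 A0 : lmodType K) := MkHA2 {
  d : {linear A1 -> A0};
  mu00 : {bilinear A0 -> A0 -> A0};
  mu01 : {bilinear A0 -> A1 -> A1};
  mu10 : {bilinear A1 -> A0 -> A1};
  mu3 : A0 -> A0 -> A0 -> A1;
  alpha0 : {linear A0 -> A0};
  alpha1 : {linear A1 -> A1};
  mu3_trilinear : trilinear mu3;
  alpha0_neq0 : not_zero_map alpha0;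
  alpha1_neq0 : not_zero_map alpha1;
  alpha_d : forall m, alpha0 (d m) = d (alpha1 m);
  alpha_mu3 : forall a b c,
    alpha1 (mu3 a b c) = mu3 (alpha0 a) (alpha0 b) (alpha0 c);
  alpha_mu00 : forall a b, alpha0 (mu00 a b) = mu00 (alpha0 a) (alpha0 b);
  alpha_mu01 : forall a m, alpha1 (mu01 a m) = mu01 (alpha0 a) (alpha1 m);
  alpha_mu10 : forall m a, alpha1 (mu10 m a) = mu10 (alpha1 m) (alpha0 a);
  d_mu01 : forall a m, d (mu01 a m) = mu00 a (d m);
  d_mu10 : forall m a, d (mu10 m a) = mu00 (d m) a;
  mu_dd : forall m n, mu01 (d m) n = mu10 m (d n);
  d_mu3 : forall a b c,
    d (mu3 a b c) = mu00 (mu00 a b) (alpha0 c) - mu00 (alpha0 a) (mu00 b c);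
  mu3_d3 : forall a b m,
    mu3 a b (d m) = mu01 (mu00 a b) (alpha1 m) - mu01 (alpha0 a) (mu01 b m);
  mu3_d2 : forall a m c,
    mu3 a (d m) c = mu10 (mu01 a m) (alpha0 c) - mu01 (alpha0 a) (mu10 m c);
  mu3_d1 : forall m b c,
    mu3 (d m) b c = mu10 (mu10 m b) (alpha0 c) - mu10 (alpha1 m) (mu00 b c);
  mu3_pentagon : forall a b c e,
    mu3 (mu00 a b) (alpha0 c) (alpha0 e) - mu3 (alpha0 a) (mu00 b c) (alpha0 e)
      + mu3 (alpha0 a) (alpha0 b) (mu00 c e)
    = mu10 (mu3 a b c) (alpha0 (alpha0 e)) + mu01 (alpha0 (alpha0 a)) (mu3 b c e)
}.

Definition strict (K : fieldType) (A1 A0 : lmodType K) (X : HA2 A1 A0) : Prop :=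
  forall a b c, mu3 X a b c = 0.

Definition strict_HA2 (K : fieldType) (A1 A0 : lmodType K) :=
  {X : HA2 A1 A0 | strict X}.

Record crossed_module (K : fieldType) (A B : lmodType K) := CrossedModule {
  cm_src : hom_assoc A;
  cm_tgt : hom_assoc B;
  dt : {linear A -> B};
  phil : {bilinear B -> A -> A};
  phir : {bilinear A -> B -> A};
  dt_morphism : hom_assoc_morphism cm_src cm_tgt dt;
  phi_bimodule : hom_bimodule cm_tgt (ha_alpha cm_src) phil phir;
  dt_phil : forall b m, dt (phil b m) = ha_mu cm_tgt b (dt m);
  dt_phir : forall m b, dt (phir m b) = ha_mu cm_tgt (dt m) b;
  phil_dt : forall m n, phil (dt m) n = ha_mu cm_src m n;
  phir_dt : forall m n, phir m (dt n) = ha_mu cm_src m n;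
  phil_mu : forall b m n,
    phil (ha_alpha cm_tgt b) (ha_mu cm_src m n)
    = ha_mu cm_src (phil b m) (ha_alpha cm_src n);
  phir_mu : forall m n b,
    phir (ha_mu cm_src m n) (ha_alpha cm_tgt b)
    = ha_mu cm_src (ha_alpha cm_src m) (phir n b) }.

Record corresponds (K : fieldType) (A1 A0 : lmodType K)
    (X : HA2 A1 A0) (C : crossed_module A1 A0) : Prop := Corresponds {
  corr_d : dt C =1 d X;
  corr_alpha0 : ha_alpha (cm_tgt C) =1 alpha0 X;
  corr_alpha1 : ha_alpha (cm_src C) =1 alpha1 X;
  corr_mu00 : ha_mu (cm_tgt C) =2 mu00 X;
  corr_mu01 : phil C =2 mu01 X;
  corr_mu10 : phir C =2 mu10 X;
  corr_mul : forall m n, ha_mu (cm_src C) m n = mu01 X (d X m) n }.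

(* Main.v *)
(* When mu_3 = 0, the axioms (h) and (i) are the associativity of A_0 and the
   hom-bimodule axioms for A_1; setting m n := mu_2(d m, n) = mu_2(m, d n)
   turns A_1 into a hom-associative algebra, with d as the boundary map.
   Conversely phi(dt m, n) = m n = phi(m, dt n) says that the product on the
   source of a crossed module is redundant data, and that (g) holds.  So an
   algebra and a crossed module that correspond determine each other; as
   structures with the same underlying maps are equal (by extensionality and
   proof irrelevance), the two constructions are mutually inverse. *)

Require Import Defs.
From HB Require Import structures.
From mathcomp Require Import all_boot all_order all_algebra boolp.

Set Implicit Arguments.
Unset Strict Implicit.
Unset Printing Implicit Defensive.

Import GRing.Theory.
Local Open Scope ring_scope.

(** Besides the function, the bundle packs only propositions, so function extensionality and proof
    irrelevance suffice. *)
Lemma linear_eqP (K : fieldType) (V W : lmodType K) (f g : {linear V -> W}) :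
  f =1 g -> f = g.
Proof.
case: f g => f [[af] [sf]] [g [[ag] [sg]]] /= /funext efg.
move: af sf ag sg; rewrite /= efg => af sf ag sg.
by rewrite (Prop_irrelevance af ag) (Prop_irrelevance sf sg).
Qed.

Lemma bilinear_eqP (K : fieldType) (U V W : lmodType K)
  (f g : {bilinear U -> V -> W}) : f =2 g -> f = g.
Proof.
case: f g => f [[f1 f2 f3 f4]] [g [[g1 g2 g3 g4]]] /= efg.
have {}efg : f = g by apply/funext => u; apply/funext => v; exact: efg.
subst g; rewrite (Prop_irrelevance f1 g1) (Prop_irrelevance f2 g2).
by rewrite (Prop_irrelevance f3 g3) (Prop_irrelevance f4 g4).
Qed.

Lemma hom_assoc_eqP (K : fieldType) (A : lmodType K) (S T : hom_assoc A) :
  ha_mu S =2 ha_mu T -> ha_alpha S =1 ha_alpha T -> S = T.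
Proof.
case: S T => mu al p1 p2 p3 [mu' al' q1 q2 q3] /= /bilinear_eqP e1 /linear_eqP e2.
by subst mu' al'; congr HomAssoc; exact: Prop_irrelevance.
Qed.

Section PullbackProduct.
Variables (K : fieldType) (V W : lmodType K).
Variables (f : {linear V -> W}) (l : {bilinear W -> V -> V}).

(** For [f = d] and [l = mu01] this is the product on the source of the crossed module. Naming it
    lets a bilinear structure be attached to it. *)
Definition pullback_mul (m n : V) : V := l (f m) n.

Lemma pullback_mul_is_bilinear :
  bilinear_for (GRing.Scale.Law.clone _ _ *:%R _)
    (GRing.Scale.Law.clone _ _ *:%R _) pullback_mul.
Proof.
by split=> [n | m] a x y; rewrite /pullback_mul ?linearP ?linearPl ?linearPr.
Qed.

HB.instance Definition _ :=
  bilinear_isBilinear.Build K V V V _ _ pullback_mul pullback_mul_is_bilinear.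

End PullbackProduct.

Section Correspondence.
Variables (K : fieldType) (A1 A0 : lmodType K).

Section StrictToCrossed.
Variables (X : HA2 A1 A0) (strictX : strict X).

(** Here and in the next three identities, the difference of the two sides is a value of [mu3], or
    its image under [d], and so vanishes. *)
Lemma strict_mu00A a b c :
  mu00 X (alpha0 X a) (mu00 X b c) = mu00 X (mu00 X a b) (alpha0 X c).
Proof. by apply/esym/subr0_eq; rewrite -d_mu3 strictX linear0. Qed.

Lemma strict_mu01A a b m :
  mu01 X (alpha0 X a) (mu01 X b m) = mu01 X (mu00 X a b) (alpha1 X m).
Proof. by apply/esym/subr0_eq; rewrite -mu3_d3 strictX. Qed.

Lemma strict_mu01_mu10A a m c :
  mu01 X (alpha0 X a) (mu10 X m c) = mu10 X (mu01 X a m) (alpha0 X c).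
Proof. by apply/esym/subr0_eq; rewrite -mu3_d2 strictX. Qed.

Lemma strict_mu10A m b c :
  mu10 X (alpha1 X m) (mu00 X b c) = mu10 X (mu10 X m b) (alpha0 X c).
Proof. by apply/esym/subr0_eq; rewrite -mu3_d1 strictX. Qed.

Definition tgt_of_strict : hom_assoc A0 :=
  HomAssoc (@alpha0_neq0 _ _ _ X) (alpha_mu00 X) strict_mu00A.

Definition src_of_strict : hom_assoc A1.
Proof.
apply: (@HomAssoc _ _ (pullback_mul (d X) (mu01 X)) (alpha1 X)).
- exact: alpha1_neq0.
- by move=> m n; rewrite /= /pullback_mul alpha_mu01 alpha_d.
(* Associativity is the left action law at [d m] and [d n], because [d] commutes with the twists and
   sends the product of [m] and [n] to [mu00 (d m) (d n)]. *)
- by move=> m n p; rewrite /= /pullback_mul -alpha_d strict_mu01A d_mu01.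
Defined.

Definition crossed_of_strict : crossed_module A1 A0.
Proof.
apply: (@CrossedModule _ _ _ src_of_strict tgt_of_strict
  (d X) (mu01 X) (mu10 X)).
- by split=> [m n | m]; rewrite /= ?alpha_d // /pullback_mul d_mu01.
- split=> /=; [exact: alpha_mu01 | exact: alpha_mu10 | exact: strict_mu01A |
    exact: strict_mu10A | exact: strict_mu01_mu10A].
- exact: d_mu01.
- exact: d_mu10.
- by [].
(* By [mu_dd] the product, defined through the left action, can also be read through the right
   one. *)
- by move=> m n; rewrite -mu_dd.
- by move=> b m n; rewrite /= /pullback_mul strict_mu01A d_mu01.
- by move=> m n b; rewrite /= /pullback_mul -alpha_d strict_mu01_mu10A.
Defined.

(** The constructions above are transparent, so every field holds by conversion. *)
Lemma crossed_of_strict_corresponds : corresponds X crossed_of_strict.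
Proof. by []. Qed.

End StrictToCrossed.

Section CrossedToStrict.
Variable C : crossed_module A1 A0.

Definition HA2_of_crossed : HA2 A1 A0.
Proof.
apply: (@MkHA2 _ _ _ (dt C) (ha_mu (cm_tgt C)) (phil C) (phir C)
  (fun _ _ _ => 0) (ha_alpha (cm_tgt C)) (ha_alpha (cm_src C))).
- by split=> [b c | a c | a b] k x y; rewrite scaler0 addr0.
- exact: ha_alpha_neq0.
- exact: ha_alpha_neq0.
- by move=> m; rewrite (dt_morphism C).2.
- by move=> *; rewrite linear0.
- exact: ha_alphaM.
- exact: hbm_betal (phi_bimodule C).
- exact: hbm_betar (phi_bimodule C).
- exact: dt_phil.
- exact: dt_phir.
- by move=> m n; rewrite phil_dt phir_dt.
- by move=> a b c; rewrite linear0 ha_assoc subrr.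
- by move=> a b m; rewrite (hbm_ll (phi_bimodule C)) subrr.
- by move=> a m c; rewrite (hbm_lr (phi_bimodule C)) subrr.
- by move=> m b c; rewrite (hbm_rr (phi_bimodule C)) subrr.
- by move=> a b c e; rewrite linear0l linear0r subrr addr0.
Defined.

Definition strict_of_crossed : strict_HA2 A1 A0 :=
  exist (@strict K A1 A0) HA2_of_crossed (fun _ _ _ => erefl).

Lemma strict_of_crossed_corresponds : corresponds (sval strict_of_crossed) C.
Proof. by split=> //= m n; rewrite phil_dt. Qed.

End CrossedToStrict.

(** The product on the source has no counterpart among the operations of [X]; [corr_mul] is what
    determines it. *)
Lemma corresponds_inj_crossed (X : HA2 A1 A0) (C C' : crossed_module A1 A0) :
  corresponds X C -> corresponds X C' -> C = C'.
Proof.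
case: C C' => s t f l r p1 p2 p3 p4 p5 p6 p7 p8.
case=> s' t' f' l' r' q1 q2 q3 q4 q5 q6 q7 q8 [/= a1 a2 a3 a4 a5 a6 a7].
case=> /= b1 b2 b3 b4 b5 b6 b7.
have es : s = s'.
  by apply: hom_assoc_eqP => [m n | m]; rewrite ?a7 ?b7 ?a3 ?b3.
have et : t = t'.
  by apply: hom_assoc_eqP => [m n | m]; rewrite ?a4 ?b4 ?a2 ?b2.
have ef : f = f' by apply: linear_eqP => m; rewrite a1 b1.
have el : l = l' by apply: bilinear_eqP => m n; rewrite a5 b5.
have er : r = r' by apply: bilinear_eqP => m n; rewrite a6 b6.
by subst s' t' f' l' r'; congr CrossedModule; exact: Prop_irrelevance.
Qed.

Lemma corresponds_inj_strict (X Y : strict_HA2 A1 A0)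
    (C : crossed_module A1 A0) :
  corresponds (sval X) C -> corresponds (sval Y) C -> X = Y.
Proof.
case: X Y => X sX [Y sY] /= cX cY.
suff eXY : X = Y by subst Y; congr exist; exact: Prop_irrelevance.
(* [corresponds] does not mention [mu3]; this equality comes from strictness of both algebras. *)
have e3 : mu3 X = mu3 Y.
  by do 3![apply/funext => ?]; rewrite sX sY.
case: cX cY => a1 a2 a3 a4 a5 a6 _ [b1 b2 b3 b4 b5 b6 _].
have ed : d X = d Y by apply: linear_eqP => m; rewrite -a1 b1.
have e0 : alpha0 X = alpha0 Y by apply: linear_eqP => m; rewrite -a2 b2.
have e1 : alpha1 X = alpha1 Y by apply: linear_eqP => m; rewrite -a3 b3.
have e00 : mu00 X = mu00 Y by apply: bilinear_eqP => m n; rewrite -a4 b4.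
have e01 : mu01 X = mu01 Y by apply: bilinear_eqP => m n; rewrite -a5 b5.
have e10 : mu10 X = mu10 Y by apply: bilinear_eqP => m n; rewrite -a6 b6.
clear - e3 ed e0 e1 e00 e01 e10.
case: X Y ed e0 e1 e00 e01 e10 e3.
move=> dX m00 m01 m10 m3 al0 al1 ? ? ? ? ? ? ? ? ? ? ? ? ? ? ? ?.
case=> dY n00 n01 n10 n3 be0 be1 ? ? ? ? ? ? ? ? ? ? ? ? ? ? ? ? /=.
move=> *; subst dY n00 n01 n10 n3 be0 be1.
by congr MkHA2; exact: Prop_irrelevance.
Qed.

End Correspondence.

Theorem theorem4p11 (K : fieldType) (charK0 : [pchar K]%R =i pred0) :
  exists f : forall A1 A0 : lmodType K,
      strict_HA2 A1 A0 -> crossed_module A1 A0,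
    forall A1 A0 : lmodType K,
      bijective (f A1 A0) /\
      forall X : strict_HA2 A1 A0, corresponds (sval X) (f A1 A0 X).
Proof.
exists (fun A1 A0 X => crossed_of_strict (svalP X)) => A1 A0.
have fP (X : strict_HA2 A1 A0) :
    corresponds (sval X) (crossed_of_strict (svalP X)).
  exact: crossed_of_strict_corresponds.
(* Each round trip returns a structure that corresponds to the same partner as the initial one, so
   uniqueness identifies the two. *)
split=> //; exists (@strict_of_crossed K A1 A0) => [X | C].
- apply: corresponds_inj_strict (fP X); exact: strict_of_crossed_corresponds.
- apply: corresponds_inj_crossed (fP _) _; exact: strict_of_crossed_corresponds.
Qed.
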